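(* The triangle inequality does not hold for $\widehat d_{\mathrm I}^{\mathrm{Tri}}$, $\widehat d_{\mathrm I}^{\mathrm{Cor}}$, and $\widehat d_{\mathrm I}^{\mathrm{Map}}$. That is, for each $\square\in\{\mathrm{Tri},\mathrm{Cor},\mathrm{Map}\}$ there exist finite metric spaces $X,Y,W$ with $$\widehat d_{\mathrm I}^{\square}(X,Y)>\widehat d_{\mathrm I}^{\square}(X,W)+\widehat d_{\mathrm I}^{\square}(W,Y).$$
   Context: Fix a field $\mathbb{F}$. Finite (pseudo-)metric spaces are nonempty. Vietoris–Rips FCC. For a finite pseudo-metric space $(X,d_X)$, $C_*(\mathrm{VR}(X))$ is the simplicial chain complex over $\mathbb{F}$ of the full simplex on the vertex set $X$ (points at distance $0$ remain distinct vertices), with filtration function $\ell^X(\sum\lambda_i\sigma_i)=\max_{\lambda_i\ne0}\operatorname{diam}(\sigma_i)$ (distinct simplices $\sigma_i$), $\ell^X(0)=-\infty$. Interleaving distance. For filtered chain complexes $(C_*,\ell_C)$, $(D_*,\ell_D)$ put $C_*^t=\{x:\ell_C(x)\le t\}$. They are $\delta$-interleaved if there are chain maps $f_t:C_*^t\to D_*^{t+\delta}$, $g_t:D_*^t\to C_*^{t+\delta}$ ($t\in\mathbb{R}$) commuting with the inclusions $C_*^t\hookrightarrow C_*^{t'}$, $D_*^t\hookrightarrow D_*^{t'}$ ($t\le t'$), with $g_{t+\delta}f_t$ and $f_{t+\delta}g_t$ equal to the inclusions $C_*^t\hookrightarrow C_*^{t+2\delta}$, $D_*^t\hookrightarrow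 D_*^{t+2\delta}$; $d_{\mathrm I}$ is the infimum of such $\delta\ge0$ ($\inf\emptyset=\infty$). Pullback interleaving distances. A finite tripod between $X$ and $Y$ is a finite set $Z$ with surjections $\phi_X:Z\to X$, $\phi_Y:Z\to Y$; $Z_X$ denotes $Z$ with the pseudo-metric $(z,z')\mapsto d_X(\phi_X(z),\phi_X(z'))$, similarly $Z_Y$. Define $\widehat d_{\mathrm I}^{\square}(X,Y)=\inf d_{\mathrm I}(C_*(\mathrm{VR}(Z_X)),C_*(\mathrm{VR}(Z_Y)))$, where the infimum is over: for $\square=\mathrm{Tri}$, all finite tripods; for $\square=\mathrm{Cor}$, tripods given by correspondences $Z=R\subset X\times Y$ (subsets projecting onto both factors) with the two coordinate projections; for $\square=\mathrm{Map}$, correspondences of the form $R=\{(x,f(x)):x\in X\}\cup\{(g(y),y):y\in Y\}$ for arbitrary maps $f:X\to Y$, $g:Y\to X$. *)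

(* Defs.v *)
From HB Require Import structures.
From mathcomp Require Import all_boot all_order all_algebra.
From mathcomp Require Import boolp classical_sets reals constructive_ereal ereal.

Set Implicit Arguments.
Unset Strict Implicit.
Unset Printing Implicit Defensive.

Import Order.TTheory GRing.Theory Num.Theory.
Local Open Scope ring_scope.

(* Chain complexes are graded by nat: the groups in negative degree are 0. *)
Record chain_complex (F : fieldType) := ChainComplex {
  chains :> nat -> lmodType F;
  bd : forall k, {linear chains k.+1 -> chains k};
  bd_bd : forall k (x : chains k.+2), bd k (bd k.+1 x) = 0 }.
Arguments bd {F} c k.

Record chain_map (F : fieldType) (C D : chain_complex F) := ChainMap {
  cmap :> forall k, {linear C k -> D k};
  cmap_bd : forall k (x : C k.+1), bd D k (cmap k.+1 x) = cmap k (bd C k x) }.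

(* The filtration function is given on homogeneous chains; on a sum of
   homogeneous chains it is the maximum of its values on the summands, so that
   the sublevels are determined degree by degree. *)
Record filtered_complex (F : fieldType) (R : realType) := FilteredComplex {
  fcc :> chain_complex F;
  ell : forall k, fcc k -> \bar R;
  ell_fin : forall k (x : fcc k), (ell x < +oo)%E;
  ell_eq0 : forall k (x : fcc k), ell x = -oo%E <-> x = 0;
  ell_scale : forall k (a : F) (x : fcc k), a != 0 -> ell (a *: x) = ell x;
  ell_add : forall k (x y : fcc k), (ell (x + y) <= maxe (ell x) (ell y))%E;
  ell_bd : forall k (x : fcc k.+1), (ell (bd fcc k x) <= ell x)%E }.
Arguments ell {F R} f {k} x.

Section Sublevel.
Variables (F : fieldType) (R : realType) (C : filtered_complex F R).

Definition sublevel_pred (t : R) (k : nat) : {pred C k} :=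
  [pred x | (ell C x <= t%:E)%E].

Lemma sublevel_submod_closed t k : submod_closed (@sublevel_pred t k).
Proof.
have e0 : ell C (0 : C k) = -oo%E by apply/ell_eq0.
split; first by rewrite inE e0 leNye.
move=> a x y; rewrite !inE => hx hy.
apply: le_trans (ell_add _ _) _; rewrite ge_max hy andbT.
have [->|a0] := eqVneq a 0; first by rewrite scale0r e0 leNye.
by rewrite ell_scale.
Qed.

HB.instance Definition _ t k :=
  GRing.isSubmodClosed.Build F (C k) (@sublevel_pred t k)
    (sublevel_submod_closed t k).

Record sublevel_chains (t : R) (k : nat) := SublevelChain {
  sublevel_val :> C k;
  sublevel_valP : sublevel_val \in @sublevel_pred t k }.

HB.instance Definition _ t k := [isSub for @sublevel_val t k].
HB.instance Definition _ t k := [Choice of @sublevel_chains t k by <:].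
HB.instance Definition _ t k :=
  [SubChoice_isSubLmodule of @sublevel_chains t k by <:].

Lemma sublevel_bd_subproof t k (x : sublevel_chains t k.+1) :
  bd C k (val x) \in @sublevel_pred t k.
Proof. exact: le_trans (ell_bd _) (valP x). Qed.

Definition sublevel_bd t k (x : sublevel_chains t k.+1) : sublevel_chains t k :=
  SublevelChain (sublevel_bd_subproof x).

Lemma sublevel_bd_linear t k : linear (@sublevel_bd t k).
Proof. by move=> a x y; apply: val_inj; rewrite /= !linearP. Qed.

HB.instance Definition _ t k :=
  GRing.isLinear.Build F (sublevel_chains t k.+1) (sublevel_chains t k) _
    (@sublevel_bd t k) (@sublevel_bd_linear t k).

Lemma sublevel_bd_bd t k (x : sublevel_chains t k.+2) :
  sublevel_bd (sublevel_bd x) = 0.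
Proof. by apply: val_inj; rewrite /= bd_bd. Qed.

Definition sublevel (t : R) : chain_complex F :=
  @ChainComplex F (fun k => sublevel_chains t k : lmodType F)
    (fun k => @sublevel_bd t k) (@sublevel_bd_bd t).

Section Inclusion.
Variables (t t' : R) (tt' : t <= t').

Lemma incl_subproof k (x : sublevel_chains t k) :
  val x \in @sublevel_pred t' k.
Proof. by apply: le_trans (valP x) _; rewrite lee_fin. Qed.

Definition incl_fun k (x : sublevel_chains t k) : sublevel_chains t' k :=
  SublevelChain (incl_subproof x).

Lemma incl_linear k : linear (@incl_fun k).
Proof. by move=> a x y; apply: val_inj. Qed.

HB.instance Definition _ k :=
  GRing.isLinear.Build F (sublevel_chains t k) (sublevel_chains t' k) _
    (@incl_fun k) (@incl_linear k).

Lemma incl_bd k (x : sublevel_chains t k.+1) :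
  sublevel_bd (incl_fun x) = incl_fun (sublevel_bd x).
Proof. exact: val_inj. Qed.

Definition incl : chain_map (sublevel t) (sublevel t') :=
  @ChainMap F (sublevel t) (sublevel t') (fun k => @incl_fun k) incl_bd.

End Inclusion.
End Sublevel.

Section Interleaving.
Variables (F : fieldType) (R : realType).
Implicit Types C D : filtered_complex F R.

Definition incl_natural C D (delta : R)
    (f : forall t, chain_map (sublevel C t) (sublevel D (t + delta))) : Prop :=
  forall (t t' : R) (tt' : t <= t') k (x : sublevel C t k),
    f t' k (incl C tt' k x) =
    incl D (lerD tt' (lexx delta)) k (f t k x).

Lemma le_add2 (delta t : R) : 0 <= delta -> t <= t + delta + delta.
Proof. by move=> d0; rewrite -addrA lerDl addr_ge0. Qed.

Definition composes_to_incl C D (delta : R) (d0 : 0 <= delta)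
    (f : forall t, chain_map (sublevel C t) (sublevel D (t + delta)))
    (g : forall t, chain_map (sublevel D t) (sublevel C (t + delta))) : Prop :=
  forall (t : R) k (x : sublevel C t k),
    g (t + delta) k (f t k x) = incl C (le_add2 t d0) k x.

Definition interleaved C D (delta : R) (d0 : 0 <= delta) : Prop :=
  exists (f : forall t, chain_map (sublevel C t) (sublevel D (t + delta)))
         (g : forall t, chain_map (sublevel D t) (sublevel C (t + delta))),
    [/\ incl_natural f, incl_natural g,
        composes_to_incl d0 f g & composes_to_incl d0 g f].

Definition d_I C D : \bar R :=
  ereal_inf [set e | exists (delta : R) (d0 : 0 <= delta),
                       interleaved C D d0 /\ e = delta%:E]%classic.

End Interleaving.

(* Nonemptiness is imposed in finMetric; a set surjecting onto a nonempty space
   is nonempty. *)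
Record pseudo_metric (R : realType) (X : finType) := PseudoMetric {
  dist :> X -> X -> R;
  dist_ge0 : forall x y, 0 <= dist x y;
  dist_xx : forall x, dist x x = 0;
  dist_sym : forall x y, dist x y = dist y x;
  dist_tri : forall x y z, dist x z <= dist x y + dist y z }.

Record finMetric (R : realType) := FinMetric {
  points :> finType;
  metric : pseudo_metric R points;
  metric_eq0 : forall x y, metric x y = 0 -> x = y;
  points_nonempty : (0 < #|points|)%N }.
Arguments metric {R} f.

Definition pullback (R : realType) (X Z : finType) (phi : Z -> X)
    (d : pseudo_metric R X) : pseudo_metric R Z :=
  @PseudoMetric R Z (fun z z' => d (phi z) (phi z'))
    (fun _ _ => dist_ge0 d _ _) (fun _ => dist_xx d _)
    (fun _ _ => dist_sym d _ _) (fun _ _ _ => dist_tri d _ _ _).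

Section VietorisRips.
Variables (F : fieldType) (R : realType) (X : finType).
Variable d : pseudo_metric R X.

Definition simplex (k : nat) := {A : {set X} | #|A| == k.+1}.

(* Simplices are oriented by the order in which X is enumerated; vertex_pos v A
   is the index of v in the increasing list of vertices of A. *)
Definition vertex_pos (v : X) (A : {set X}) : nat :=
  #|[set w in A | (enum_rank w < enum_rank v)%N]|.

Definition vr_chains (k : nat) : lmodType F := {ffun simplex k -> F^o}.

(* Linear extension of sigma |-> \sum_(v in sigma) (-1)^(pos v) (sigma \ v). *)
Definition vr_bd_fun (k : nat) (c : vr_chains k.+1) : vr_chains k :=
  [ffun tau : simplex k =>
     \sum_(sigma : simplex k.+1)
       \sum_(v in val sigma | val sigma :\ v == val tau)
         (-1) ^+ vertex_pos v (val sigma) * c sigma].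

Lemma vr_bd_linear k : linear (@vr_bd_fun k).
Proof.
move=> a x y; apply/ffunP => tau; rewrite !ffunE scaler_sumr -big_split /=.
apply: eq_bigr => s _; rewrite scaler_sumr -big_split /=.
apply: eq_bigr => v _; rewrite !ffunE mulrDr; congr (_ + _).
by rewrite /GRing.scale /= mulrCA.
Qed.

HB.instance Definition _ k :=
  GRing.isLinear.Build F (vr_chains k.+1) (vr_chains k) _
    (@vr_bd_fun k) (@vr_bd_linear k).

Lemma vertex_pos_sign (u v : X) (A : {set X}) :
    (enum_rank u < enum_rank v)%N -> u \in A ->
  ((-1) ^+ vertex_pos u A * (-1) ^+ vertex_pos v (A :\ u) =
   - ((-1) ^+ vertex_pos v A * (-1) ^+ vertex_pos u (A :\ v)) :> F).
Proof.
move=> uv uA.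
have -> : vertex_pos u (A :\ v) = vertex_pos u A.
  apply: eq_card => w; rewrite !inE; case: (eqVneq w v) => //= ->.
  by rewrite [(enum_rank v < _)%N]ltnNge (ltnW uv) andbF.
have -> : vertex_pos v A = (vertex_pos v (A :\ u)).+1.
  rewrite /vertex_pos (cardsD1 u) inE uA uv add1n; congr _.+1.
  by apply: eq_card => w; rewrite !inE andbA.
by rewrite exprS mulN1r mulNr opprK mulrC.
Qed.

Lemma vr_bd_bd k (c : vr_chains k.+2) : vr_bd_fun (vr_bd_fun c) = 0.
Proof.
apply/ffunP => rho; rewrite !ffunE.
under eq_bigr => tau _ do under eq_bigr => v _ do
  rewrite ffunE mulr_sumr.
under eq_bigr => tau _ do rewrite exchange_big /=.
rewrite exchange_big /= big1 // => s _.
pose T u v := ((-1) ^+ vertex_pos u (val s) *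
  (-1) ^+ vertex_pos v (val s :\ u) * c s : F).
pose P u v := [&& u \in val s, v \in val s :\ u & val s :\ u :\ v == val rho].
transitivity (\sum_u \sum_(v | P u v) T u v).
  rewrite (eq_bigr (fun tau : simplex k.+1 => \sum_(u in val s | val s :\ u == val tau)
     \sum_(v | P u v) T u v)); last first.
    move=> tau _; under eq_bigr do rewrite mulr_sumr.
    rewrite (exchange_big_dep (fun u => (u \in val s) && (val s :\ u == val tau))) //=.
    apply: eq_bigr => u /andP[us /eqP tauE].
    apply: eq_big => v; rewrite /P /T us tauE ?eqxx ?andbT //=.
    by move=> _; rewrite mulrCA mulrA.
  rewrite (exchange_big_dep (fun u => u \in val s)) /=; last by move=> ? ? _ /andP[].
  rewrite big_mkcond /=; apply: eq_bigr => u _.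
  case: ifP => us; last by rewrite big_pred0 // => v; rewrite /P us.
  have cu : #|val s :\ u| == k.+2.
    by have := valP s; rewrite /= (cardsD1 u) us add1n eqSS.
  rewrite (big_pred1 (Sub (val s :\ u) cu : simplex k.+1)) // => tau.
  by rewrite us -val_eqE eq_sym.
pose lt (u v : X) := (enum_rank u < enum_rank v)%N.
have Psym u v : P u v = P v u.
  have -> : P u v = [&& u \in val s, v \in val s, v != u & val s :\ u :\ v == val rho].
    by rewrite /P !inE andbA [in RHS]andbCA !andbA; do 3?case: (_ \in _); rewrite ?andbF ?andbT.
  rewrite /P !inE finset.setDDl finset.setUC -finset.setDDl eq_sym.
  by case: (u \in _); case: (v \in _); rewrite ?andbF ?andbT.
under eq_bigr => u _ do rewrite (bigID (lt u)) /=.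
rewrite big_split /=; apply/eqP; rewrite addrC addr_eq0; apply/eqP.
rewrite (exchange_big_dep xpredT) //= -sumrN; apply: eq_bigr => u _.
rewrite -sumrN; apply: eq_big => [v | v /andP[Pv nlt]].
  rewrite Psym; case Puv: (P u v) => //=.
  have uv : v != u by case/and3P: Puv => _; rewrite !inE => /andP[].
  rewrite /lt -leqNgt leq_eqVlt; case: eqP => //= /val_inj/enum_rank_inj e.
  by rewrite e eqxx in uv.
have [vs us _] := and3P Pv; have uvlt : lt u v.
  rewrite /lt ltn_neqAle leqNgt nlt andbT; apply/eqP => /val_inj/enum_rank_inj e.
  by move: us; rewrite e !inE eqxx.
rewrite /T -mulNr [in RHS]vertex_pos_sign ?opprK //.
by move: us; rewrite !inE => /andP[].
Qed.

Definition vr_complex : chain_complex F :=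
  @ChainComplex F vr_chains (fun k => @vr_bd_fun k) vr_bd_bd.

Definition diam (A : {set X}) : R :=
  \big[Num.max/0]_(x in A) \big[Num.max/0]_(y in A) d x y.

Definition vr_ell (k : nat) (c : vr_chains k) : \bar R :=
  \big[maxe/-oo%E]_(sigma : simplex k | c sigma != 0) (diam (val sigma))%:E.

Lemma diamS (A B : {set X}) : A \subset B -> diam A <= diam B.
Proof.
move=> /fintype.subsetP AB.
have ge0 (P : pred X) (f : X -> R) : 0 <= \big[Num.max/0]_(x | P x) f x.
  by rewrite bigmax_ge_id.
apply/bigmax_leP; split=> [|x xA]; first exact: ge0.
apply/bigmax_leP; split=> [|y yA]; first exact: ge0.
apply: le_trans (le_bigmax_cond _ _ (AB _ xA)).
exact: (le_bigmax_cond _ (fun y => d x y) (AB _ yA)).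
Qed.

Lemma vr_ell_leP k (c : vr_chains k) (e : \bar R) :
  (vr_ell c <= e)%E <->
  (forall s, c s != 0 -> ((diam (val s))%:E <= e)%E).
Proof.
split=> [/bigmax_leP[_ h] // | h].
by apply/bigmax_leP; split=> //; exact: leNye.
Qed.

Lemma vr_ell_fin k (c : vr_chains k) : (vr_ell c < +oo)%E.
Proof. by apply/bigmax_ltP; split=> // s _; rewrite ltry. Qed.

Lemma vr_ell_eq0 k (c : vr_chains k) : vr_ell c = -oo%E <-> c = 0.
Proof.
split=> [h | ->]; last by rewrite /vr_ell big_pred0 // => s; rewrite ffunE eqxx.
apply/ffunP => s; rewrite ffunE; apply/eqP/negP => /negP cs.
by have /vr_ell_leP/(_ s cs) : (vr_ell c <= -oo)%E by rewrite h.
Qed.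

Lemma vr_ell_scale k (a : F) (c : vr_chains k) :
  a != 0 -> vr_ell (a *: c) = vr_ell c.
Proof.
move=> a0; apply: eq_bigl => s.
by rewrite ffunE /GRing.scale /= mulf_eq0 (negbTE a0).
Qed.

Lemma vr_ell_add k (c c' : vr_chains k) :
  (vr_ell (c + c') <= maxe (vr_ell c) (vr_ell c'))%E.
Proof.
apply/vr_ell_leP => s; rewrite ffunE le_max => nz.
have [cs|cs] := eqVneq (c s) 0.
  apply/orP; right; apply: (vr_ell_leP c' _).1 => //.
  by apply: contraNneq nz => ->; rewrite cs addr0.
by apply/orP; left; apply: (vr_ell_leP c _).1.
Qed.

Lemma vr_ell_bd k (c : vr_chains k.+1) : (vr_ell (vr_bd_fun c) <= vr_ell c)%E.
Proof.
apply/vr_ell_leP => t; rewrite ffunE => nz.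
have [s /andP[cs ts]] : exists s : simplex k.+1, (c s != 0) && ((val t \subset val s)).
  apply/existsP; apply: contraNT nz => /existsPn h.
  rewrite big1 // => s _; rewrite big1 // => v /andP[_ /eqP e].
  have := h s; rewrite -e finset.subD1set andbT negbK => /eqP ->.
  by rewrite mulr0.
apply: le_trans ((vr_ell_leP c _).1 (lexx _) s cs).
by rewrite lee_fin diamS.
Qed.

Definition VR : filtered_complex F R :=
  @FilteredComplex F R vr_complex vr_ell vr_ell_fin vr_ell_eq0 vr_ell_scale
    vr_ell_add vr_ell_bd.

End VietorisRips.

Section PullbackInterleaving.
Variables (F : fieldType) (R : realType) (X Y : finMetric R).

Definition surjection (Z T : Type) (phi : Z -> T) : Prop :=
  forall y, exists z, phi z = y.

Definition tripod_dist (Z : finType) (phiX : Z -> X) (phiY : Z -> Y) : \bar R :=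
  d_I (VR F (pullback phiX (metric X))) (VR F (pullback phiY (metric Y))).

Definition correspondence (S : {set X * Y}) : Prop :=
  (forall x, exists y, (x, y) \in S) /\ (forall y, exists x, (x, y) \in S).

Definition cor_dist (S : {set X * Y}) : \bar R :=
  @tripod_dist {p : X * Y | p \in S} (fun p => (val p).1) (fun p => (val p).2).

Definition map_cor (f : X -> Y) (g : Y -> X) : {set X * Y} :=
  [set (x, f x) | x in X] :|: [set (g y, y) | y in Y].

Definition dhat_Tri : \bar R :=
  ereal_inf [set e | exists (Z : finType) (phiX : Z -> X) (phiY : Z -> Y),
    [/\ surjection phiX, surjection phiY & e = tripod_dist phiX phiY]]%classic.

Definition dhat_Cor : \bar R :=
  ereal_inf [set e | exists S : {set X * Y},
    correspondence S /\ e = cor_dist S]%classic.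

Definition dhat_Map : \bar R :=
  ereal_inf [set e | exists (f : X -> Y) (g : Y -> X),
    e = cor_dist (map_cor f g)]%classic.

End PullbackInterleaving.

Variant tripod_kind := Tri | Cor | Map.

Definition dhat (F : fieldType) (R : realType) (sq : tripod_kind)
    (X Y : finMetric R) : \bar R :=
  match sq with
  | Tri => dhat_Tri F X Y
  | Cor => dhat_Cor F X Y
  | Map => dhat_Map F X Y
  end.

(* Main.v *)
From HB Require Import structures.
Require Import Defs.
From mathcomp Require Import all_boot all_order all_algebra.
From mathcomp Require Import boolp reals constructive_ereal ereal zify.

Set Implicit Arguments.
Unset Strict Implicit.
Unset Printing Implicit Defensive.

Import Order.TTheory GRing.Theory Num.Theory.
Local Open Scope ring_scope.

(* The compositions in an interleaving are inclusions on the nose, so d_I sees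
   the verbose barcode, and d_I < 1 between complexes with integral filtration
   values forces the sublevels to have equal dimensions.  For ultrametrics the
   converse holds: the sublevels are acyclic in positive degrees, and equality
   of all dimensions yields a filtered isomorphism.  These dimensions only
   depend on the multisets of cluster sizes at each height, where the tripod
   chooses the multiplicities of the points.  Take five points a, ..., e and the
   dendrograms, with mergers at heights 1, 2, 3, 4,
     X = ((ab)c)(de),  W = (((ab)c)d)e,  Y = (ab)((cd)e).
   X and W have the same cluster sizes when e has multiplicity 3 in both; W and Y
   do when e has multiplicity 2 in W and c has multiplicity 2 in Y.  Since these
   multiplicities on W are not proportional, nothing transfers to X and Y, and
   in fact no multiplicities make the cluster sizes of X and Y agree. *)

(** * Lifting isomorphisms along flags *)

(** Each map is precomposed with the projection onto its own summand along the other one; that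
    projection kills the other summand. *)
Lemma lfun_glue (K : fieldType) (V V' : vectType K) (A B : {vspace V})
    (f g : 'Hom(V, V')) :
  (A :&: B = 0)%VS ->
  exists h : 'Hom(V, V'), {in A, h =1 f} /\ {in B, h =1 g}.
Proof.
move=> AB0; have BA0 : (B :&: A = 0)%VS by rewrite capvC.
have pi0 C E u : (C :&: E = 0)%VS -> u \in C -> daddv_pi E C u = 0.
  move=> CE0 uC; apply: (addrI (daddv_pi C E u)).
  by rewrite addr0 daddv_pi_add ?daddv_pi_id ?(subvP (addvSl C E)).
exists ((f \o daddv_pi A B) + (g \o daddv_pi B A))%VF; split=> u uX.
  by rewrite add_lfunE !comp_lfunE daddv_pi_id // pi0 // linear0 addr0.
by rewrite add_lfunE !comp_lfunE (daddv_pi_id BA0) // pi0 // linear0 add0r.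
Qed.

Lemma lfun_iso_dim (K : fieldType) (V V' : vectType K) (P : {vspace V})
    (P' : {vspace V'}) :
  \dim P = \dim P' ->
  exists g : 'Hom(V, V'), (P :&: lker g = 0)%VS /\ (g @: P = P')%VS.
Proof.
move=> dPP'.
have [f fE] := linear_of_free (vbasis P) (vbasis P').
have img : (linfun f @: P = P')%VS.
  rewrite -{1}(span_basis (vbasisP P)) limg_span.
  rewrite (eq_map (lfunE f)) fE ?(span_basis (vbasisP P')) //.
    exact: basis_free (vbasisP P).
  by rewrite !size_tuple dPP'.
exists (linfun f); split=> //; apply/eqP; rewrite -dimv_eq0.
by rewrite -(eqn_add2r (\dim (linfun f @: P))) limg_ker_dim img dPP'.
Qed.

(** The map [D \o projv T] has image [D @: T], so its pseudo-inverse is a section there; a further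
    projection makes it land in [T]. *)
Lemma lfun_section (K : fieldType) (V U : vectType K) (T : {vspace V})
    (D : 'Hom(V, U)) :
  exists s : 'Hom(U, V), {in (D @: T)%VS, forall u, s u \in T /\ D (s u) = u}.
Proof.
exists (projv T \o (D \o projv T)^-1)%VF => u uDT.
rewrite comp_lfunE memv_proj -comp_lfunE -comp_lfunE; split=> //.
rewrite 2!comp_lfunE -[RHS](@limg_lfunVK _ _ _ (D \o projv T)%VF) ?comp_lfunE //.
by rewrite limg_comp limg_proj.
Qed.

Section Lifting.
Variables (K : fieldType) (V V' U U' : vectType K).
Variables (D : 'Hom(V, U)) (D' : 'Hom(V', U')) (phi : 'Hom(U, U')).
Hypothesis phi_inj : injective phi.

(* T is split as S + P + Q, where P is a complement of S in S + (T meet ker D).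
   On P any isomorphism onto the analogous space of T' will do, and on Q, where D
   is injective modulo D S, one lifts phi o D. *)
Lemma lift_iso_step (S T : {vspace V}) (S' T' : {vspace V'}) (f : 'Hom(V, V')) :
    (S <= T)%VS -> (S' <= T')%VS -> \dim S = \dim S' -> \dim T = \dim T' ->
    (phi @: (D @: T) = D' @: T')%VS ->
    (S :&: lker f = 0)%VS -> (f @: S = S')%VS ->
    {in S, forall v, D' (f v) = phi (D v)} ->
  exists g : 'Hom(V, V'),
    [/\ {in S, g =1 f}, (T :&: lker g = 0)%VS, (g @: T = T')%VS &
        {in T, forall v, D' (g v) = phi (D v)}].
Proof.
move=> ST ST' dS dT phiT kerf imf fD.
have kphi : lker phi == 0%VS by apply/lker0P.
have dphi (W : {vspace U}) : \dim (phi @: W) = \dim W.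
  by apply: limg_dim_eq; rewrite (eqP kphi) capv0.
have phiS : (phi @: (D @: S) = D' @: S')%VS.
  by rewrite -imf -!limg_comp; apply: eq_in_limg => v vS; rewrite !comp_lfunE fD.
pose Z := (T :&: lker D)%VS; pose Z' := (T' :&: lker D')%VS.
have ZS : (Z :&: S = S :&: lker D)%VS.
  by rewrite /Z capvC capvA (capv_idPl ST).
have ZS' : (Z' :&: S' = S' :&: lker D')%VS.
  by rewrite /Z' capvC capvA (capv_idPl ST').
pose P := (Z :\: S)%VS; pose P' := (Z' :\: S')%VS.
(* Here dim P = dim (T meet ker D) - dim (S meet ker D). By rank-nullity both terms depend only on
   the dimensions of S, T and their images, and [phi] preserves the latter. *)
have dP : \dim P = \dim P'.
  apply/eqP; rewrite -(eqn_add2l (\dim (S :&: lker D))) -{1}ZS dimv_cap_compl.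
  have -> : \dim (S :&: lker D) = \dim (S' :&: lker D').
    apply/eqP; rewrite -(eqn_add2r (\dim (D @: S))) limg_ker_dim dS.
    by rewrite -dphi phiS limg_ker_dim.
  rewrite -ZS' dimv_cap_compl -(eqn_add2r (\dim (D @: T))) limg_ker_dim dT.
  by rewrite -dphi phiT limg_ker_dim.
have [b [kerb imb]] := lfun_iso_dim dP.
have [s sP] := lfun_section T' D'.
pose Q := (T :\: (S + Z)%VS)%VS.
have SP0 : (S :&: P = 0)%VS by rewrite capvC capv_diff.
have SPE : (S + P = S + Z)%VS by rewrite addvC addv_diff addvC.
have SPQ0 : ((S + P) :&: Q = 0)%VS by rewrite SPE capvC capv_diff.
have TE : (S + P + Q = T)%VS.
  rewrite SPE addvC addv_diff; apply/addv_idPl.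
  by rewrite subv_add ST capvSl.
have [h [hS hP]] := lfun_glue f b SP0.
have [g [gSP gQ]] := lfun_glue h (s \o phi \o D)%VF SPQ0.
have gS : {in S, g =1 f}.
  by move=> v vS; rewrite gSP ?hS //; apply: subvP (addvSl S P) v vS.
have gP : {in P, g =1 b}.
  by move=> v vP; rewrite gSP ?hP //; apply: subvP (addvSr S P) v vP.
have PZ v : v \in P -> v \in T /\ D v = 0.
  by move/(subvP (diffvSl _ _)); rewrite memv_cap memv_ker => /andP[-> /eqP].
have bP v : v \in P -> [/\ b v \in P', b v \in T' & D' (b v) = 0].
  move=> vP; have bvP : b v \in P' by rewrite -imb memv_img.
  by move/(subvP (diffvSl _ _)): (bvP); rewrite memv_cap memv_ker => /andP[-> /eqP].
have QT v : v \in Q -> v \in T by move/(subvP (diffvSl _ _)).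
have gQP v : v \in Q -> g v \in T' /\ D' (g v) = phi (D v).
  move=> vQ; rewrite gQ // !comp_lfunE; apply: sP.
  by rewrite -phiT !memv_img ?QT.
have TP v : v \in T -> exists x y z, [/\ x \in S, y \in P, z \in Q & v = x + y + z].
  by rewrite -TE => /memv_addP[w /memv_addP[x xS [y yP ->]] [z zQ ->]]; exists x, y, z.
have fS v : v \in S -> f v \in S' by move=> vS; rewrite -imf memv_img.
have gD : {in T, forall v, D' (g v) = phi (D v)}.
  move=> v /TP[x [y [z [xS yP zQ ->]]]]; rewrite !linearD /= gS // gP // fD //.
  by have [_ _ ->] := bP _ yP; have [_ ->] := PZ _ yP; have [_ ->] := gQP _ zQ; rewrite linear0.
(* If g v = 0 for v = x + y + z, then D v = 0 by injectivity of [phi], so z lies in Q and in S + Z,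
   hence vanishes. Then b y lies in P' and in S', which kills y, and finally x. *)
have kerg : (T :&: lker g = 0)%VS.
  apply/eqP; rewrite -subv0; apply/subvP => v; rewrite memv_cap memv_ker => /andP[vT].
  have /TP[x [y [z [xS yP zQ vE]]]] := vT; move=> /eqP gv0; rewrite memv0.
  have Dv0 : D v = 0 by apply: phi_inj; rewrite -gD // gv0 !linear0.
  have z0 : z = 0.
    apply/eqP; rewrite -memv0 -(capv_diff T (S + Z)%VS) memv_cap zQ /=.
    have vZ : v \in Z by rewrite memv_cap vT memv_ker Dv0 eqxx.
    have yZ : y \in Z by rewrite memv_cap memv_ker; have [-> ->] := PZ _ yP; rewrite eqxx.
    have -> : z = - x + (v - y).
      by rewrite vE [x + y + z - y]addrAC addrK addKr.
    by rewrite memv_add ?memvN ?memvB.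
  move: vE gv0; rewrite z0 addr0 => ->; rewrite linearD /= gS // gP // => fb0.
  have y0 : y = 0.
    apply/eqP; rewrite -memv0 -kerb memv_cap yP memv_ker -memv0.
    have [byP _ _] := bP _ yP; rewrite -(capv_diff Z' S') memv_cap byP /=.
    by move/eqP: fb0; rewrite addrC addr_eq0 => /eqP ->; rewrite memvN fS.
  move: fb0; rewrite y0 linear0 !addr0 => fx0.
  by rewrite -memv0 -kerf memv_cap xS memv_ker fx0 eqxx.
exists g; split=> //.
apply/eqP; rewrite eqEdim limg_dim_eq // dT leqnn andbT.
apply/subvP => _ /memv_imgP[v /TP[x [y [z [xS yP zQ ->]]]] ->].
rewrite !linearD /= gS // gP // !memvD //.
- exact: subvP ST' _ (fS _ xS).
- by have [] := bP _ yP.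
- by have [] := gQP _ zQ.
Qed.

(** Start from the zero subspace and extend along the flag one step at a time; since each map
    extends the previous one, the images already matched stay matched. *)
Lemma lift_iso_flag (S : nat -> {vspace V}) (S' : nat -> {vspace V'}) (m : nat) :
    {homo S : i j / (i <= j)%N >-> (i <= j)%VS} ->
    {homo S' : i j / (i <= j)%N >-> (i <= j)%VS} ->
    (forall j, \dim (S j) = \dim (S' j)) ->
    (forall j, (phi @: (D @: S j) = D' @: S' j)%VS) ->
  exists g : 'Hom(V, V'),
    [/\ (S m :&: lker g = 0)%VS, {in S m, forall v, D' (g v) = phi (D v)} &
        forall j, (j <= m)%N -> (g @: S j = S' j)%VS].
Proof.
move=> Sm Sm' dS phiS; elim: m => [|m [g [kerg gD gS]]].
  have [] := @lift_iso_step 0%VS (S 0) 0%VS (S' 0) 0 _ _ _ (dS _) (phiS _);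
    rewrite ?sub0v ?cap0v ?lim0g ?dimv0 //.
    by move=> v; rewrite memv0 => /eqP ->; rewrite !linear0.
  by move=> g [_ kerg imgg gD]; exists g; split=> // j; rewrite leqn0 => /eqP ->.
have [] := @lift_iso_step (S m) (S m.+1) (S' m) (S' m.+1) g (Sm _ _ (leqnSn m))
  (Sm' _ _ (leqnSn m)) (dS m) (dS _) (phiS _) kerg (gS m (leqnn m)) gD.
move=> h [hg kerh imh hD]; exists h; split=> // j.
rewrite leq_eqVlt => /predU1P[-> //|]; rewrite ltnS => jm.
rewrite -gS //; apply: eq_in_limg => v vj; apply: hg.
exact: subvP (Sm _ _ jm) v vj.
Qed.

End Lifting.

(** * Simplices inside the fibers of a labelling *)

Section SupportedFunctions.
Variables (F : fieldType) (I : finType) (P : pred I).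

Definition ext_fun (f : {ffun {i | P i} -> F^o}) : {ffun I -> F^o} :=
  [ffun i => oapp f 0 (insub i)].

Lemma ext_fun_linear : linear ext_fun.
Proof.
move=> a f g; apply/ffunP => i; rewrite !ffunE.
by case: insub => [s|] /=; rewrite ?ffunE ?scaler0 ?addr0.
Qed.

HB.instance Definition _ :=
  GRing.isLinear.Build F {ffun {i | P i} -> F^o} {ffun I -> F^o} _
    ext_fun ext_fun_linear.

(** Presented as the image of extension by zero, which is injective, so that the dimension is read
    off the domain. *)
Definition supp_space : {vspace {ffun I -> F^o}} := limg (linfun ext_fun).

Lemma supp_spaceP (c : {ffun I -> F^o}) :
  reflect (forall i, c i != 0 -> P i) (c \in supp_space).
Proof.
apply: (iffP memv_imgP) => [[f _ ->] i|cP].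
  by rewrite lfunE ffunE; case: insubP => //=; rewrite eqxx.
exists [ffun s => c (val s)]; first exact: memvf.
apply/ffunP => i; rewrite lfunE !ffunE; case: insubP => /= [s _ <-|nPi].
  by rewrite ffunE.
by apply/eqP; apply: contraNT nPi; exact: cP.
Qed.

Lemma dim_supp_space : \dim supp_space = #|P|.
Proof.
rewrite limg_dim_eq; last first.
  apply/eqP; rewrite -subv0; apply/subvP => f; rewrite capfv memv_ker memv0.
  rewrite lfunE => /eqP/ffunP f0; apply/eqP/ffunP => s.
  by have := f0 (val s); rewrite !ffunE valK.
by rewrite dimvf /dim /= muln1 card_sig.
Qed.

End SupportedFunctions.

(** * Cones over clusters *)

Section Cone.
Variables (F : fieldType) (Z : finType) (T : eqType) (l : Z -> T).
Implicit Types (A : {set Z}) (v z : Z).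

Definition const_on A := [forall x in A, forall y in A, l x == l y].

Lemma const_onP A :
  reflect {in A &, forall x y, l x = l y} (const_on A).
Proof.
apply: (iffP forall_inP) => [h x y xA yA|h x xA].
  by apply/eqP; exact: (forall_inP (h x xA)).
by apply/forall_inP => y yA; rewrite (h x y).
Qed.

Lemma const_onS A (B : {set Z}) : A \subset B -> const_on B -> const_on A.
Proof.
by move=> /subsetP AB /const_onP cB; apply/const_onP => x y /AB xB /AB; exact: cB.
Qed.

Lemma const_onU1 a A v : a \in A -> const_on A -> const_on (v |: A) = (l v == l a).
Proof.
move=> aA /const_onP cA; apply/const_onP/eqP => [cvA|lva x y].
  by apply: cvA; rewrite !inE ?eqxx ?aA ?orbT.
have lE z : z \in v |: A -> l z = l a.
  by rewrite !inE => /predU1P[->|zA] //; exact: cA.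
by move=> /lE -> /lE ->.
Qed.

(** Extension by zero to all subsets, so that vertices can be added and removed without carrying
    cardinality proofs. *)
Definition coeff k (c : {ffun simplex Z k -> F^o}) A : F := oapp c 0 (insub A).

Lemma coeff_val k (c : {ffun simplex Z k -> F^o}) s : coeff c (val s) = c s.
Proof. by rewrite /coeff valK. Qed.

Lemma coeff_Sub k (c : {ffun simplex Z k -> F^o}) A (cA : #|A| == k.+1) :
  coeff c A = c (Sub A cA).
Proof. by rewrite /coeff insubT. Qed.

Lemma coeff_card k (c : {ffun simplex Z k -> F^o}) A :
  #|A| != k.+1 -> coeff c A = 0.
Proof. by move=> cA; rewrite /coeff insubF //; apply: negbTE. Qed.

Lemma vr_bdE k (c : {ffun simplex Z k.+1 -> F^o}) (tau : simplex Z k) :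
  (vr_bd_fun c : {ffun simplex Z k -> F^o}) tau =
  \sum_(v | v \notin val tau)
     (-1) ^+ vertex_pos v (val tau) * coeff c (v |: val tau).
Proof.
rewrite ffunE (exchange_big_dep xpredT) //= [RHS]big_mkcond.
apply: eq_bigr => v _; case: ifPn => [vt|]; last first.
  rewrite negbK => vt; apply: big1 => s /andP[_ /eqP st].
  by move: vt; rewrite -st !inE eqxx.
have cvt : #|v |: val tau| == k.+2 by rewrite cardsU1 vt (eqP (valP tau)).
rewrite (big_pred1 (Sub (v |: val tau) cvt : simplex Z k.+1)) => [|s].
  (* The position of v counts strictly smaller vertices, so it is the same in [val tau] and in
     [v |: val tau]. *)
  rewrite coeff_Sub; congr (_ ^+ _ * _); apply: eq_card => w /=.
  rewrite !inE; case: eqVneq => //= ->.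
  by rewrite ltnn andbF.
rewrite /= -(inj_eq val_inj s); apply/andP/eqP => [[vs /eqP st]|->].
  by rewrite -[LHS](setD1K vs) st.
by rewrite setU11 setU1K.
Qed.

(* The apex of the cone is the first vertex of the cluster in the enumeration, so
   that it always has position 0 and enters simplices with sign +1. *)
Definition base z : Z := [arg min_(w < z | l w == l z) enum_rank w].

Lemma baseP z : l (base z) = l z /\
  forall w, l w = l z -> (enum_rank (base z) <= enum_rank w)%N.
Proof.
rewrite /base; case: arg_minnP => // w /eqP lw wmin; split=> // u lu.
by apply: wmin; rewrite lu.
Qed.

Lemma base_eq z w : l z = l w -> base z = base w.
Proof.
move=> lzw; have [bz mz] := baseP z; have [bw mw] := baseP w.
apply: enum_rank_inj; apply: val_inj; apply/eqP; rewrite eqn_leq.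
by rewrite mz ?mw ?bz ?bw ?lzw.
Qed.

Lemma base_lt z w : l w = l z -> w != base z ->
  (enum_rank (base z) < enum_rank w)%N.
Proof.
move=> lwz wb; rewrite ltn_neqAle (baseP z).2 // andbT.
by apply: contraNneq wb => /val_inj/enum_rank_inj ->.
Qed.

(** A cluster contains a single vertex fixed by [base], so the sum has at most one term: the face
    opposite the apex. *)
Definition cone k (c : {ffun simplex Z k -> F^o}) : {ffun simplex Z k.+1 -> F^o} :=
  [ffun s : simplex Z k.+1 => if const_on (val s) then
     \sum_(p in val s | base p == p) coeff c (val s :\ p) else 0].

Lemma coeff_cone k (c : {ffun simplex Z k -> F^o}) A a : a \in A ->
  coeff (cone c) A =
  if const_on A && (base a \in A) then coeff c (A :\ base a) else 0.
Proof.
move=> aA; have [cA|cA] := boolP (const_on A); last first.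
  rewrite /coeff; case: insubP => //= s _ sA.
  by rewrite ffunE /= sA (negbTE cA).
have baseE p : p \in A -> base p = base a.
  by move=> pA; apply: base_eq; apply: (const_onP _ cA).
transitivity (\sum_(p in A | base p == p) coeff c (A :\ p)).
  have [cd|cd] := boolP (#|A| == k.+2).
    by rewrite coeff_Sub ffunE /= cA.
  rewrite coeff_card // big1 // => p /andP[pA _]; apply: coeff_card.
  by apply: contra cd => /eqP cd; rewrite (cardsD1 p) pA cd.
rewrite /=; case: ifPn => baA; last first.
  rewrite big_pred0 // => p; apply: contraNF baA => /andP[pA /eqP bp].
  by rewrite -(baseE p) // bp.
rewrite (big_pred1 (base a)) // => p /=.
apply/andP/eqP => [[pA /eqP <-]|->]; first exact: baseE.
by rewrite baA baseE // eqxx.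
Qed.

Lemma vertex_pos_base A a : const_on A -> a \in A -> vertex_pos (base a) A = 0%N.
Proof.
move=> /const_onP cA aA; apply: eq_card0 => w; rewrite !inE.
apply/negbTE; rewrite negb_and -implybE -leqNgt; apply/implyP => wA.
by apply: (baseP a).2; apply: cA.
Qed.

(** Coning contracts each cluster: this is the homotopy formula bd cone + cone bd = id in positive
    degree, applied to a cycle. *)
Lemma cone_bd k (c : {ffun simplex Z k.+1 -> F^o}) :
  (forall s, c s != 0 -> const_on (val s)) ->
  vr_bd_fun c = 0 -> vr_bd_fun (cone c) = c.
Proof.
move=> cl bc0.
have cl0 A : ~~ const_on A -> coeff c A = 0.
  move=> nA; rewrite /coeff; case: insubP => //= s _ sA.
  by apply/eqP; apply: contraNT nA => /cl; rewrite -sA.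
apply/ffunP => tau; rewrite vr_bdE -coeff_val; set A := val tau.
have cardA : #|A| = k.+2 by apply/eqP; exact: valP tau.
have /set0Pn[a aA] : A != finset.set0 by rewrite -card_gt0 cardA.
have aU v : a \in v |: A by rewrite !inE aA orbT.
have [cA|cA] := boolP (const_on A); last first.
  rewrite cl0 // big1 // => v _; rewrite (coeff_cone _ (aU v)).
  by rewrite (negbTE (contra (const_onS (subsetUr _ _)) cA)) mulr0.
set p := base a; have lpa : l p = l a by have [] := baseP a.
(* If the apex p is missing from A, only v = p contributes, with sign +1. Otherwise the terms are
   the coefficients of c at v added to A minus p, and the vanishing of the boundary at A minus p
   turns their sum into the coefficient at A. *)
have [pA|pA] := boolP (p \in A); last first.
  rewrite (bigD1 p) //= vertex_pos_base // expr0 mul1r (coeff_cone _ (aU p)).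
  rewrite (const_onU1 _ aA) // lpa eqxx setU11 /= setU1K // big1 ?addr0 // => v.
  move=> /andP[vA vp]; rewrite (coeff_cone _ (aU v)) -/p !inE eq_sym (negbTE vp).
  by rewrite (negbTE pA) andbF mulr0.
have cardA' : #|A :\ p| == k.+1.
  by rewrite -eqSS -cardA (cardsD1 p A) pA.
have /set0Pn[b bA'] : A :\ p != finset.set0 by rewrite -card_gt0 (eqP cardA').
have cA' : const_on (A :\ p) by apply: const_onS cA; apply: subD1set.
have bA : b \in A by move: bA'; rewrite !inE => /andP[].
have lba : l b = l a by apply: (const_onP _ cA).
have pb : p = base b by apply: base_eq.
have /ffunP/(_ (Sub (A :\ p) cardA')) := bc0.
rewrite vr_bdE [in RHS]ffunE (bigD1 p) /=; last by rewrite !inE eqxx.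
rewrite [X in vertex_pos X]pb vertex_pos_base // expr0 mul1r setD1K //.
move/eqP; rewrite addr_eq0 => /eqP ->; rewrite -sumrN.
apply: eq_big => [v|v vA].
  by rewrite !inE; case: eqVneq => [->|_]; rewrite ?andbT ?pA.
have vp : v != p by apply: contraNneq vA => ->.
rewrite (coeff_cone _ (aU v)) -/p !inE pA orbT andbT (const_onU1 _ aA) //.
case: eqP => lva; last first.
  rewrite cl0 ?mulr0 ?oppr0 // (const_onU1 _ bA') // lba; exact/eqP.
have -> : (v |: A) :\ p = v |: (A :\ p).
  by apply/setP => w; rewrite !inE; case: (eqVneq w v) => [->|]; rewrite ?vp ?andbT.
(* The apex precedes v, so removing it shifts the position by one and supplies the sign. *)
have -> : vertex_pos v A = (vertex_pos v (A :\ p)).+1.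
  rewrite /vertex_pos (cardsD1 p) inE pA base_lt // add1n; congr _.+1.
  by apply: eq_card => w; rewrite !inE andbA.
by rewrite exprS mulN1r mulNr.
Qed.

Lemma cone_const k (c : {ffun simplex Z k -> F^o}) s :
  cone c s != 0 -> const_on (val s).
Proof. by rewrite ffunE; case: ifP => //; rewrite eqxx. Qed.

End Cone.

(** Simplices are nonempty, so one with constant label lies in exactly one fiber. *)
Lemma card_const_simplices (Z T : finType) (l : Z -> T) k :
  #|[pred s : simplex Z k | const_on l (val s)]| =
  (\sum_t 'C(#|[pred z | l z == t]|, k.+1))%N.
Proof.
rewrite -(card_imset _ val_inj) -sum1_card big_mkcond /=.
under [RHS]eq_bigr => t _ do
  rewrite -(cardsE [pred z | l z == t]) -cards_draws -sum1_card big_mkcond /=.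
rewrite exchange_big /=; apply: eq_bigr => A _.
have [cA|cA] := boolP (#|A| == k.+1); last first.
  rewrite big1 => [|t _]; last by rewrite inE (negbTE cA) andbF.
  case: imsetP => // -[s _ sA]; case/negP: cA; rewrite sA; exact: valP s.
have /set0Pn[a aA] : A != finset.set0 by rewrite -card_gt0 (eqP cA).
rewrite (bigD1 (l a)) //= big1 ?addn0 => [|t ta].
  congr (if _ then _ else _); rewrite inE cA andbT.
  apply/imsetP/subsetP => [[s sl sA] x xA|Al].
    by rewrite !inE; apply/eqP; apply: (const_onP _ _ sl); rewrite -sA.
  exists (Sub A cA : simplex Z k) => //; rewrite inE; apply/const_onP => x y.
  by move=> /Al; rewrite !inE => /eqP -> /Al; rewrite !inE => /eqP ->.
rewrite inE cA andbT; case: subsetP => // /(_ a aA); rewrite !inE => /eqP lat.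
by rewrite lat eqxx in ta.
Qed.

(** * Filtered maps and integral ultrametrics *)

Section FilteredMap.
Variables (F : fieldType) (R : realType) (C D : filtered_complex F R).
Variable phi : chain_map C D.
Hypothesis phi_ell : forall k (x : C k), (ell D (phi k x) <= ell C x)%E.
Variables (t t' : R).
Hypothesis tt' : t <= t'.

Lemma sublevel_map_subproof k (x : sublevel_chains C t k) :
  phi k (val x) \in @sublevel_pred F R D t' k.
Proof.
by apply: le_trans (phi_ell _) _; apply: le_trans (valP x) _; rewrite lee_fin.
Qed.

Definition sublevel_map_fun k (x : sublevel_chains C t k) : sublevel_chains D t' k :=
  SublevelChain (sublevel_map_subproof x).

Lemma sublevel_map_linear k : linear (@sublevel_map_fun k).
Proof. by move=> a x y; apply: val_inj; rewrite /= linearP. Qed.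

HB.instance Definition _ k :=
  GRing.isLinear.Build F (sublevel_chains C t k) (sublevel_chains D t' k) _
    (@sublevel_map_fun k) (@sublevel_map_linear k).

Lemma sublevel_map_bd k (x : sublevel_chains C t k.+1) :
  sublevel_bd (sublevel_map_fun x) = sublevel_map_fun (sublevel_bd x).
Proof. by apply: val_inj; rewrite /= cmap_bd. Qed.

Definition sublevel_map : chain_map (sublevel C t) (sublevel D t') :=
  @ChainMap F (sublevel C t) (sublevel D t') (fun k => @sublevel_map_fun k)
    sublevel_map_bd.

End FilteredMap.

Lemma d_I_le0 (F : fieldType) (R : realType) (C D : filtered_complex F R)
    (phi : chain_map C D) (psi : chain_map D C) :
    (forall k (x : C k), (ell D (phi k x) <= ell C x)%E) ->
    (forall k (x : D k), (ell C (psi k x) <= ell D x)%E) ->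
    (forall k, cancel (phi k) (psi k)) -> (forall k, cancel (psi k) (phi k)) ->
  (d_I C D <= 0)%E.
Proof.
move=> hphi hpsi phiK psiK; apply: ereal_inf_lbound; exists 0, (lexx 0); split=> //.
(* The sublevel at [t + 0] is not convertible to the one at [t], which is why [sublevel_map] allows
   a larger target level. *)
have le0 (t : R) : t <= t + 0 by rewrite addr0.
exists (fun t => sublevel_map hphi (le0 t)), (fun t => sublevel_map hpsi (le0 t)).
by split=> [t t' tt' k x|t t' tt' k x|t k x|t k x]; apply: val_inj; rewrite /= ?phiK ?psiK.
Qed.

Lemma d_I_ge (F : fieldType) (R : realType) (C D : filtered_complex F R) (e : R) :
    (forall (delta : R) (d0 : 0 <= delta), interleaved C D d0 -> e <= delta) ->
  (e%:E <= d_I C D)%E.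
Proof.
move=> h; apply: le_ereal_inf_tmp => _ [delta [d0 [CD ->]]].
by rewrite lee_fin; apply: h CD.
Qed.

Lemma interleaved_sym (F : fieldType) (R : realType) (C D : filtered_complex F R)
    (delta : R) (d0 : 0 <= delta) :
  interleaved C D d0 -> interleaved D C d0.
Proof. by case=> f [g [? ? ? ?]]; exists g, f. Qed.

(** Encodes an ultrametric by its clusters at natural heights; quantifying over real [t] forces the
    distances to be integers. *)
Definition level_labels (R : realType) (Z L : finType) (d : pseudo_metric R Z)
    (lab : nat -> Z -> L) : Prop :=
  forall x y t, 0 <= t ->
    (d x y <= t) = (lab (Num.truncn t) x == lab (Num.truncn t) y).

Section Levels.
Variables (F : fieldType) (R : realType) (Z L : finType) (d : pseudo_metric R Z).
Variable lab : nat -> Z -> L.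
Hypothesis dlab : level_labels d lab.

(** The sublevel at height j, by [vr_ell_le], as a subspace of a finite-dimensional space, where
    dimensions are available. *)
Definition level_space j k : {vspace {ffun simplex Z k -> F^o}} :=
  supp_space F [pred s : simplex Z k | const_on (lab j) (val s)].

Definition bd_lfun k : 'Hom({ffun simplex Z k.+1 -> F^o}, {ffun simplex Z k -> F^o}) :=
  linfun (@vr_bd_fun F Z k).

Lemma bd_lfunE k c : bd_lfun k c = vr_bd_fun c.
Proof. by rewrite lfunE. Qed.

Lemma labS i j x y : (i <= j)%N -> lab i x = lab i y -> lab j x = lab j y.
Proof.
have labE k : (lab k x == lab k y) = (d x y <= k%:R) by rewrite dlab ?ler0n ?natrK.
move=> ij /eqP; rewrite labE => dij; apply/eqP; rewrite labE.
by apply: le_trans dij _; rewrite ler_nat.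
Qed.

Lemma diam_le A (t : R) : 0 <= t ->
  (diam d A <= t) = const_on (lab (Num.truncn t)) A.
Proof.
move=> t0; apply/bigmax_leP/const_onP => [[_ h] x y xA yA|h].
  apply/eqP; rewrite -dlab //.
  by have /bigmax_leP[_] := h x xA; apply.
split=> // x xA; apply/bigmax_leP; split=> // y yA.
by rewrite dlab // (h x y).
Qed.

Lemma vr_ell_le k (c : {ffun simplex Z k -> F^o}) (t : R) : 0 <= t ->
  (vr_ell d c <= t%:E)%E = (c \in level_space (Num.truncn t) k).
Proof.
move=> t0; apply/idP/supp_spaceP => [/vr_ell_leP h s /h|h].
  by rewrite lee_fin diam_le.
by apply/vr_ell_leP => s /h; rewrite lee_fin diam_le.
Qed.

Lemma vr_ell_ge0 k (c : {ffun simplex Z k -> F^o}) : c != 0 -> (0 <= vr_ell d c)%E.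
Proof.
move=> c0; have [s cs] : exists s, c s != 0.
  apply/existsP; apply: contraNT c0 => /existsPn h; apply/eqP/ffunP => s.
  by rewrite ffunE; apply/eqP; have := h s; rewrite negbK.
apply: le_trans ((vr_ell_leP d c _).1 (lexx _) s cs).
by rewrite lee_fin /diam bigmax_ge_id.
Qed.

Lemma level_spaceS k : {homo level_space^~ k : i j / (i <= j)%N >-> (i <= j)%VS}.
Proof.
move=> i j ij; apply/subvP => c /supp_spaceP cP; apply/supp_spaceP => s /cP.
by move=> /const_onP h; apply/const_onP => x y xs ys; apply: labS ij _; apply: h.
Qed.

Lemma level_space0 j : level_space j 0 = fullv.
Proof.
apply/vspaceP => c; rewrite memvf; apply/supp_spaceP => s _; apply/const_onP.
move=> x y; case/cards1P: (valP s) => z -> /finset.set1P -> /finset.set1P ->.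
by [].
Qed.

Lemma level_space_full m j k : (forall x y, lab m x = lab m y) -> (m <= j)%N ->
  level_space j k = fullv.
Proof.
move=> labm mj; apply/vspaceP => c; rewrite memvf; apply/supp_spaceP => s _.
by apply/const_onP => x y _ _; apply: labS mj _; apply: labm.
Qed.

Lemma level_space_big j k : (#|Z| <= k)%N -> level_space j k = 0%VS.
Proof.
move=> Zk; apply/eqP; rewrite -subv0; apply/subvP => c _; rewrite memv0.
apply/eqP/ffunP => s; have := max_card (mem (val s)).
by rewrite (eqP (valP s)) leqNgt ltnS Zk.
Qed.

(** The cone of a chain is supported in clusters of the same height, so cycles are filled without
    leaving the level. *)
Lemma level_space_acyclic j k :
  (level_space j k.+1 :&: lker (bd_lfun k) = bd_lfun k.+1 @: level_space j k.+2)%VS.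
Proof.
apply/vspaceP => c; apply/idP/memv_imgP => [|[b bC ->]].
  rewrite memv_cap memv_ker bd_lfunE => /andP[/supp_spaceP cC /eqP bc0].
  exists (cone (lab j) c); last by rewrite bd_lfunE (cone_bd cC).
  by apply/supp_spaceP => s; apply: cone_const.
rewrite memv_cap memv_ker !bd_lfunE; apply/andP; split; last exact/eqP/vr_bd_bd.
move: bC; rewrite -(@natrK R j) -!vr_ell_le ?ler0n //.
by apply: le_trans; apply: vr_ell_bd.
Qed.

Lemma dim_level_space j k :
  \dim (level_space j k) = (\sum_a 'C(#|[pred z | lab j z == a]|, k.+1))%N.
Proof. by rewrite dim_supp_space -card_const_simplices. Qed.

End Levels.

(** * Filtered isomorphism from equality of dimensions *)

Section FilteredIso.
Variables (F : fieldType) (R : realType) (Z L Z' L' : finType).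
Variables (d : pseudo_metric R Z) (d' : pseudo_metric R Z').
Variables (lab : nat -> Z -> L) (lab' : nat -> Z' -> L') (m : nat).
Hypothesis dlab : level_labels d lab.
Hypothesis dlab' : level_labels d' lab'.
Hypothesis labm : forall x y, lab m x = lab m y.
Hypothesis labm' : forall x y, lab' m x = lab' m y.

Local Notation C := (level_space F lab).
Local Notation C' := (level_space F lab').

Hypothesis dimC : forall j k, \dim (C j k) = \dim (C' j k).

Let B j k := (bd_lfun F Z k @: C j k.+1)%VS.
Let B' j k := (bd_lfun F Z' k @: C' j k.+1)%VS.

(* By acyclicity dim B_k + dim B_(k+1) = dim C_(k+1), and C_k = 0 for k large. *)
Lemma dim_boundaries j k : \dim (B j k) = \dim (B' j k).
Proof.
have [n] : exists n, (#|Z| <= k.+1 + n)%N by exists #|Z|; rewrite leq_addl.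
elim: n k => [|n IH] k Zk.
  have C0 : C j k.+1 = 0%VS by apply: level_space_big; rewrite addn0 in Zk.
  have C'0 : C' j k.+1 = 0%VS.
    by apply/eqP; rewrite -dimv_eq0 -dimC C0 dimv0.
  by rewrite /B /B' C0 C'0 !limg0 !dimv0.
apply/eqP; rewrite -(eqn_add2l (\dim (C j k.+1 :&: lker (bd_lfun F Z k)))).
rewrite limg_ker_dim dimC (level_space_acyclic F dlab) (IH k.+1); last by rewrite addSnnS.
by rewrite /B' -(level_space_acyclic F dlab') limg_ker_dim.
Qed.

(** Matching the boundaries is the compatibility that [lift_iso_flag] asks for in order to lift to
    the next degree. *)
Let flag_iso k (f : 'Hom({ffun simplex Z k -> F^o}, {ffun simplex Z' k -> F^o})) :=
  [/\ injective f, forall j, (f @: C j k = C' j k)%VS &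
      forall j, (f @: B j k = B' j k)%VS].

Let C_full j k : (m <= j)%N -> C j k = fullv.
Proof. exact: (level_space_full F dlab). Qed.
Let C'_full j k : (m <= j)%N -> C' j k = fullv.
Proof. exact: (level_space_full F dlab'). Qed.

Let dim_full k : \dim {: {ffun simplex Z k -> F^o}} = \dim {: {ffun simplex Z' k -> F^o}}.
Proof. by rewrite -(C_full k (leqnn m)) -(C'_full k (leqnn m)). Qed.

Let lker0_inj k (f : 'Hom({ffun simplex Z k -> F^o}, {ffun simplex Z' k -> F^o})) :
  (fullv :&: lker f = 0)%VS -> injective f.
Proof. by rewrite capfv => /eqP/lker0P. Qed.

Let B_S k : {homo B^~ k : i j / (i <= j)%N >-> (i <= j)%VS}.
Proof. by move=> i j ij; apply: limgS; apply: (level_spaceS _ dlab). Qed.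
Let B'_S k : {homo B'^~ k : i j / (i <= j)%N >-> (i <= j)%VS}.
Proof. by move=> i j ij; apply: limgS; apply: (level_spaceS _ dlab'). Qed.

(** In degree 0 every level space is full, so only the flag of boundaries has to be respected. *)
Lemma flag_iso0 : {f | @flag_iso 0 f}.
Proof.
apply: cid.
(* The flag of boundaries is continued by the whole space at index m + 1, which makes the resulting
   map a global isomorphism; zero differentials impose no further condition. *)
pose S j := if (j <= m)%N then B j 0 else fullv.
pose S' j := if (j <= m)%N then B' j 0 else fullv.
have homoS (vT : vectType F) (E : nat -> {vspace vT}) :
    {homo E : i j / (i <= j)%N >-> (i <= j)%VS} ->
    {homo (fun j => if (j <= m)%N then E j else fullv) :
       i j / (i <= j)%N >-> (i <= j)%VS}.
  move=> hE i j ij /=; case: ifP => im; case: ifP => jm; rewrite ?subvf ?hE //.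
  by rewrite (leq_trans ij jm) in im.
have id_inj : injective (\1%VF : 'End(F^o)) by move=> x y; rewrite !id_lfunE.
have [||j|j|g [kerg _ gS]] := @lift_iso_flag F _ _ _ _ 0 0 _ id_inj S S' m.+1.
- by apply: homoS; apply: B_S.
- by apply: homoS; apply: B'_S.
- by rewrite /S /S'; case: ifP => _; [exact: dim_boundaries|exact: dim_full].
- by rewrite !lim0g limg0.
have Sm : S m.+1 = fullv by rewrite /S ltnn.
exists g; split.
- by apply: lker0_inj; rewrite -Sm.
- by move=> j; rewrite !level_space0; have := gS _ (leqnn _); rewrite /S /S' ltnn.
move=> j; have gB i : (i <= m)%N -> (g @: B i 0 = B' i 0)%VS.
  by move=> im; have := gS i (leqW im); rewrite /S /S' im.
have [/gB //|/ltnW mj] := leqP j m.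
by have := gB m (leqnn m); rewrite /B /B' !(C_full, C'_full).
Qed.

(** Lifting through the differentials matches the level spaces. Boundaries follow by acyclicity:
    they are the cycles of the level, and g preserves and reflects cycles because f is injective. *)
Lemma flag_iso_step k (f : {f | @flag_iso k f}) :
  {g | @flag_iso k.+1 g &
       forall c, bd_lfun F Z' k (g c) = sval f (bd_lfun F Z k c)}.
Proof.
case: f => f [f_inj fC fB] /=; apply: cid2.
have [|j|j|g [kerg gD gC]] := @lift_iso_flag F _ _ _ _ (bd_lfun F Z k) (bd_lfun F Z' k)
  f f_inj (C^~ k.+1) (C'^~ k.+1) m (level_spaceS _ dlab k.+1).
- exact: (level_spaceS _ dlab').
- exact: dimC.
- exact: fB.
rewrite C_full // in kerg gD.
have g_inj := lker0_inj kerg.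
have gD' c : bd_lfun F Z' k (g c) = f (bd_lfun F Z k c) by rewrite gD ?memvf.
have gC' j : (g @: C j k.+1 = C' j k.+1)%VS.
  have [/gC //|/ltnW mj] := leqP j m.
  by have := gC m (leqnn m); rewrite !(C_full, C'_full).
exists g => //; split=> // j.
rewrite /B /B' -(level_space_acyclic F dlab) -(level_space_acyclic F dlab').
rewrite -gC'; apply/eqP; rewrite eqEsubv; apply/andP; split; apply/subvP => c.
  case/memv_imgP => v; rewrite memv_cap memv_ker => /andP[vC /eqP bv0] ->.
  by rewrite memv_cap memv_img // memv_ker gD' bv0 linear0 eqxx.
rewrite memv_cap => /andP[/memv_imgP[v vC ->]]; rewrite memv_ker gD' => /eqP fbv.
apply: memv_img; rewrite memv_cap vC memv_ker; apply/eqP; apply: f_inj.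
by rewrite fbv linear0.
Qed.

(** The isomorphisms come as sigma types so that each can be chosen over the one in the degree
    below. *)
Fixpoint flag_iso_seq k : {f | @flag_iso k f} :=
  if k is k'.+1 then
    let: exist2 g gg _ := flag_iso_step (flag_iso_seq k') in exist _ g gg
  else flag_iso0.

Lemma flag_iso_seq_bd k c :
  bd_lfun F Z' k (sval (flag_iso_seq k.+1) c) = sval (flag_iso_seq k) (bd_lfun F Z k c).
Proof. by rewrite /=; case: (flag_iso_step _). Qed.

Lemma d_I_level_le0 : (d_I (VR F d) (VR F d') <= 0)%E.
Proof.
pose f k := sval (flag_iso_seq k).
have f_inj k : injective (f k) by case: (svalP (flag_iso_seq k)).
have fC j k : (f k @: C j k = C' j k)%VS by case: (svalP (flag_iso_seq k)).
have fK k : cancel (f k) (f k)^-1%VF by apply: lker0_lfunK; apply/lker0P; exact: f_inj.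
have fVK k : cancel (f k)^-1%VF (f k).
  move=> c; apply: limg_lfunVK.
  by rewrite -(C_full k (leqnn m)) fC C'_full ?memvf.
have fbd k c : vr_bd_fun (f k.+1 c) = f k (vr_bd_fun c).
  by rewrite -bd_lfunE flag_iso_seq_bd bd_lfunE.
have fVbd k c : vr_bd_fun ((f k.+1)^-1%VF c) = (f k)^-1%VF (vr_bd_fun c).
  by apply: (can_inj (fK k)); rewrite fVK -fbd fVK.
pose phi := @ChainMap F (VR F d) (VR F d') (fun k => f k) (fun k c => fbd k c).
pose psi := @ChainMap F (VR F d') (VR F d) (fun k => (f k)^-1%VF) (fun k c => fVbd k c).
(* A nonzero chain has a value r >= 0, and the sublevel at r is a level space; preserving level
   spaces thus bounds the filtration. *)
have ell_le (Z1 L1 Z2 L2 : finType) (d1 : pseudo_metric R Z1) (d2 : pseudo_metric R Z2)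
   (lab1 : nat -> Z1 -> L1) (lab2 : nat -> Z2 -> L2) k
   (h : 'Hom({ffun simplex Z1 k -> F^o}, {ffun simplex Z2 k -> F^o})) :
   level_labels d1 lab1 -> level_labels d2 lab2 ->
   (forall j, h @: level_space F lab1 j k <= level_space F lab2 j k)%VS ->
   forall c, (vr_ell d2 (h c) <= vr_ell d1 c)%E.
  move=> dl1 dl2 hC c; have [->|c0] := eqVneq c 0.
    by rewrite linear0 (vr_ell_eq0 _ _).2 ?leNye // (vr_ell_eq0 _ _).2.
  have := vr_ell_ge0 d1 c0; have := vr_ell_fin d1 c.
  case e: (vr_ell d1 c) => [r||] // _; rewrite lee_fin => r0.
  rewrite (vr_ell_le dl2) //; apply: (subvP (hC _)); apply: memv_img.
  by rewrite -(vr_ell_le dl1) // e.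
apply: (@d_I_le0 F R (VR F d) (VR F d') phi psi) => k //=.
- by apply: (ell_le _ _ _ _ _ _ _ _ _ _ dlab dlab') => j; rewrite fC.
- apply: (ell_le _ _ _ _ _ _ _ _ _ _ dlab' dlab) => j.
  apply/subvP => _ /memv_imgP[v vC ->]; move: vC.
  by rewrite -fC => /memv_imgP[w wC ->]; rewrite fK.
- exact: fK.
- exact: fVK.
Qed.

End FilteredIso.

(** As g after f is an inclusion, f is injective on the sublevel at j. It lands in the sublevel at j
    + delta, which for delta < 1 is again level j. *)
Lemma interleaved_dim_le (F : fieldType) (R : realType) (Z L Z' L' : finType)
    (d : pseudo_metric R Z) (d' : pseudo_metric R Z')
    (lab : nat -> Z -> L) (lab' : nat -> Z' -> L') (delta : R) (d0 : 0 <= delta) :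
    level_labels d lab -> level_labels d' lab' -> delta < 1 ->
    interleaved (VR F d) (VR F d') d0 ->
  forall j k, (\dim (level_space F lab j k) <= \dim (level_space F lab' j k))%N.
Proof.
move=> dlab dlab' d1 [f [g [_ _ fg _]]] j k.
have memC c : (c \in @sublevel_pred F R (VR F d) j%:R k) = (c \in level_space F lab j k).
  by rewrite inE /= (vr_ell_le dlab) ?ler0n // natrK.
have projC c : projv (level_space F lab j k) c \in @sublevel_pred F R (VR F d) j%:R k.
  by rewrite memC memv_proj.
(* Projecting to the level space first makes f a linear map on the whole chain space, as [linfun]
   requires. *)
pose restr c : sublevel_chains (VR F d) j%:R k := SublevelChain (projC c).
have restrE c : val (restr c) = projv (level_space F lab j k) c by [].
have restr_lin : linear restr.
  by move=> a x y; apply: val_inj; rewrite linearP !restrE linearP.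
pose h c : {ffun simplex Z' k -> F^o} := val (f j%:R k (restr c)).
have h_lin : linear h by move=> a x y; rewrite /h restr_lin !linearP.
pose hL := GRing.isLinear.Build F _ _ _ h h_lin.
pose hl : {linear _ -> _} := HB.pack h hL.
have hE : linfun hl =1 h by move=> c; rewrite lfunE.
have hC : (linfun hl @: level_space F lab j k <= level_space F lab' j k)%VS.
  apply/subvP => _ /memv_imgP[c _ ->]; rewrite hE /h.
  have := valP (f j%:R k (restr c)).
  rewrite inE /= (vr_ell_le dlab') ?addr_ge0 ?ler0n //.
  suff -> : Num.truncn (j%:R + delta) = j by [].
  by apply: truncn_def; rewrite lerDl d0 -natr1 ltrD2l.
apply: leq_trans (dimvS hC); rewrite limg_dim_eq //.
apply/eqP; rewrite -subv0; apply/subvP => c; rewrite memv_cap memv_ker hE.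
move=> /andP[cC /eqP hc0].
have fr0 : f j%:R k (restr c) = 0 by apply: val_inj.
have := fg j%:R k (restr c); rewrite fr0 linear0 => /(congr1 val) /=.
by rewrite projv_id // memv0 => <-.
Qed.

(** * Pullback distances and dendrograms *)

Section Pullback.
Variables (F : fieldType) (R : realType) (X Y : finMetric R).

Definition cor_tripod (S : {set X * Y}) : finType := {p : X * Y | p \in S}.

Lemma correspondence_surj (S : {set X * Y}) : correspondence S ->
  surjection (fun p : cor_tripod S => (val p).1) /\
  surjection (fun p : cor_tripod S => (val p).2).
Proof.
move=> [Sx Sy]; split=> [x|y].
  by have [y xyS] := Sx x; exists (Sub (x, y) xyS).
by have [x xyS] := Sy y; exists (Sub (x, y) xyS).
Qed.

Lemma mem_map_cor (f : X -> Y) (g : Y -> X) x y :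
  ((x, y) \in map_cor f g) = (y == f x) || (x == g y).
Proof.
rewrite inE; congr (_ || _); apply/imsetP/eqP => [[z _ [-> ->]] //|->].
  by exists x.
by exists y.
Qed.

Lemma map_cor_correspondence (f : X -> Y) (g : Y -> X) :
  correspondence (map_cor f g).
Proof.
by split=> [x|y]; [exists (f x)|exists (g y)]; rewrite mem_map_cor eqxx ?orbT.
Qed.

Lemma dhat_le_map sq (f : X -> Y) (g : Y -> X) :
  (dhat F sq X Y <= cor_dist F (map_cor f g))%E.
Proof.
have cor := map_cor_correspondence f g.
case: sq; apply: ereal_inf_lbound.
- have [s1 s2] := correspondence_surj cor.
  by exists (cor_tripod (map_cor f g)), (fun p => (val p).1), (fun p => (val p).2).
- by exists (map_cor f g).
- by exists f, g.
Qed.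

(** All three kinds range over tripods, so a bound over all tripods serves each of them. *)
Lemma dhat_ge_tripod sq (e : \bar R) :
    (forall (Z : finType) (phi : Z -> X) (psi : Z -> Y),
      surjection phi -> surjection psi -> (e <= tripod_dist F phi psi)%E) ->
  (e <= dhat F sq X Y)%E.
Proof.
move=> h; case: sq; apply: le_ereal_inf_tmp => c.
- by move=> [Z [phi [psi [s1 s2 ->]]]]; apply: h.
- by move=> [S [/correspondence_surj[s1 s2] ->]]; apply: h.
- move=> [f [g ->]]; have [s1 s2] := correspondence_surj (map_cor_correspondence f g).
  exact: h.
Qed.

End Pullback.

(** * The ultrametric of a sequence of mergers *)

Section MergeSpace.
Variables (T : finType) (s : seq (T * T)).

(* The clusters of the dendrogram are labelled by their representatives; the
   j-th merger, at height j.+1, relabels one cluster by another. *)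
Definition merge_label (j : nat) (x : T) : T :=
  foldl (fun y p => if y == p.1 then p.2 else y) x (take j s).

(** Labels that agree once agree forever, so counting the heights that separate x and y gives the
    first height at which they meet; in this form the triangle inequality holds term by term. *)
Definition merge_height (x y : T) : nat :=
  \sum_(j < size s) (merge_label j x != merge_label j y).

Hypothesis merge_connected : forall x y,
  merge_label (size s) x = merge_label (size s) y.

Lemma merge_labelS i j x y : (i <= j)%N ->
  merge_label i x = merge_label i y -> merge_label j x = merge_label j y.
Proof.
move=> ij e; have labE z : merge_label j z =
    foldl (fun y p => if y == p.1 then p.2 else y) (merge_label i z)
      (drop i (take j s)).
  by rewrite /merge_label -foldl_cat -{1}(cat_take_drop i (take j s)) take_takel.
by rewrite !labE e.
Qed.

Lemma merge_height_le x y j :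
  (merge_height x y <= j)%N = (merge_label j x == merge_label j y).
Proof.
have [e|ne] := eqVneq (merge_label j x) (merge_label j y).
  rewrite /merge_height (big_ord_widen_cond _ xpredT (fun i =>
    (merge_label i x != merge_label i y) : nat) (leq_maxl (size s) j)) /=.
  rewrite big_mkcond (bigID (fun i : 'I__ => (i < j)%N)) /= [X in (_ + X)%N]big1 ?addn0.
    apply: leq_trans (_ : \sum_(i < maxn (size s) j | (i < j)%N) 1 <= j)%N.
      by apply: leq_sum => i _; case: ifP => // _; apply: leq_b1.
    by rewrite -(big_ord_widen_cond _ xpredT (fun=> 1%N)) ?leq_maxr // sum1_card card_ord.
  by move=> i; rewrite -leqNgt => ji; rewrite (merge_labelS ji e) eqxx if_same.
have js : (j < size s)%N.
  by rewrite ltnNge; apply: contra ne => sj; rewrite (merge_labelS sj (merge_connected x y)).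
apply/negbTE; rewrite -ltnNge /merge_height.
rewrite (bigID (fun i : 'I__ => (i < j.+1)%N)) /=; apply: leq_trans (leq_addr _ _).
rewrite -(big_ord_widen_cond _ xpredT (fun i =>
    (merge_label i x != merge_label i y) : nat)) //.
rewrite (eq_bigr (fun=> 1%N)) ?sum1_card ?card_ord // => i _.
suff -> : merge_label i x != merge_label i y by [].
by apply: contra ne => /eqP e; rewrite (merge_labelS _ e) // -ltnS.
Qed.

Variable R : realType.

Let mdist x y : R := (merge_height x y)%:R.

Let mdist_xx x : mdist x x = 0.
Proof. by rewrite /mdist /merge_height big1 // => i _; rewrite eqxx. Qed.

Let mdist_sym x y : mdist x y = mdist y x.
Proof. by congr _%:R; apply: eq_bigr => i _; rewrite eq_sym. Qed.

Let mdist_tri x y z : mdist x z <= mdist x y + mdist y z.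
Proof.
rewrite /mdist -natrD ler_nat -big_split; apply: leq_sum => i _ /=.
case: (eqVneq (merge_label i x) (merge_label i y)) => [->|_] //.
by apply: leq_trans (leq_b1 _) _; rewrite leq_addr.
Qed.

Definition merge_metric : pseudo_metric R T :=
  @Defs.PseudoMetric R T mdist (fun _ _ => ler0n _ _) mdist_xx mdist_sym mdist_tri.

Lemma merge_metric_eq0 x y : merge_metric x y = 0 -> x = y.
Proof.
move/eqP; rewrite pnatr_eq0 -leqn0 merge_height_le /merge_label take0.
by move/eqP.
Qed.

Hypothesis T_gt0 : (0 < #|T|)%N.

Definition merge_space : finMetric R :=
  @FinMetric R T merge_metric merge_metric_eq0 T_gt0.

Lemma level_labels_merge (Z : finType) (phi : Z -> merge_space) :
  level_labels (pullback phi (metric merge_space)) (fun j z => merge_label j (phi z)).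
Proof.
move=> x y t t0; rewrite /= /mdist -merge_height_le.
by rewrite -truncn_ge_nat.
Qed.

End MergeSpace.

(** * The counterexample *)

(* Merging clusters of sizes p and q creates p q new edges and
   p q (p + q - 2) / 2 new triangles. *)
Lemma merge_sizes p q p' q' : (0 < p)%N -> (0 < q)%N ->
    ('C(p + q, 2) + ('C(p', 2) + 'C(q', 2)) =
     'C(p' + q', 2) + ('C(p, 2) + 'C(q, 2)))%N ->
    ('C(p + q, 3) + ('C(p', 3) + 'C(q', 3)) =
     'C(p' + q', 3) + ('C(p, 3) + 'C(q, 3)))%N ->
  (p + q = p' + q')%N.
Proof.
have bin2D a b : ('C(a + b, 2) = 'C(a, 2) + 'C(b, 2) + a * b)%N.
  elim: a => [|a IH]; first by rewrite !add0n ?mul0n ?addn0.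
  by rewrite addSn !binS !bin1 IH; lia.
have bin3D a b : ('C(a + b, 3) = 'C(a, 3) + 'C(b, 3) + 'C(a, 2) * b + a * 'C(b, 2))%N.
  elim: a => [|a IH]; first by rewrite !add0n ?mul0n ?addn0.
  by rewrite addSn !(binS _ 2) IH bin2D !binS !bin1; lia.
have bin2E a : (2 * 'C(a, 2) + a = a * a)%N.
  by elim: a => [|a IH]; rewrite ?bin0n // binS bin1; lia.
move=> p0 q0; rewrite !bin2D !bin3D => e2 e3.
have epq : (p * q = p' * q')%N by lia.
have {e2 e3} e : ('C(p, 2) * q + p * 'C(q, 2) = 'C(p', 2) * q' + p' * 'C(q', 2))%N.
  by lia.
have doubled a b :
    (a * b * (a + b) = 2 * ('C(a, 2) * b + a * 'C(b, 2)) + 2 * (a * b))%N.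
  have -> : (a * b * (a + b) = a * a * b + a * (b * b))%N by lia.
  by rewrite -!bin2E; lia.
(* The two counts determine p q and p q (p + q); cancelling the positive p q leaves the sum. *)
apply/eqP; rewrite -(eqn_pmul2l (_ : 0 < p * q)%N) ?muln_gt0 ?p0 //.
by rewrite doubled e epq -doubled.
Qed.

(** Reduction modulo 5 turns any numeral into a point without a proof, so closed statements are
    settled by computation. *)
Definition pt (n : nat) : 'I_5 := Ordinal (ltn_pmod n (isT : 0 < 5)%N).
Definition pts (s : seq nat) (x : 'I_5) : 'I_5 := pt (nth 0%N s x).

Lemma ord5P (P : 'I_5 -> Prop) :
  P (pt 0) -> P (pt 1) -> P (pt 2) -> P (pt 3) -> P (pt 4) -> forall x, P x.
Proof.
move=> P0 P1 P2 P3 P4 [[|[|[|[|[|//]]]]] h];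
  [move: P0|move: P1|move: P2|move: P3|move: P4]; congr P; exact: val_inj.
Qed.

Lemma big_pt (V : Type) (idx : V) (op : Monoid.com_law idx) (P : pred 'I_5)
    (G : 'I_5 -> V) :
  \big[op/idx]_(x | P x) G x =
  \big[op/idx]_(x <- [:: pt 0; pt 1; pt 2; pt 3; pt 4] | P x) G x.
Proof.
apply: perm_big; apply: uniq_perm; rewrite ?index_enum_uniq //.
by apply: ord5P; rewrite mem_index_enum.
Qed.

Definition merger_seq (s : seq (nat * nat)) := [seq (pt p.1, pt p.2) | p <- s].

(** Points 0, ..., 4 stand for a, ..., e, and a cluster is represented by its smallest point. *)
Definition mergersX := merger_seq [:: (1, 0); (2, 0); (4, 3); (3, 0)]%N.
Definition mergersY := merger_seq [:: (1, 0); (3, 2); (4, 2); (2, 0)]%N.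
Definition mergersW := merger_seq [:: (1, 0); (2, 0); (3, 0); (4, 0)]%N.

Lemma connectedX x y :
  merge_label mergersX (size mergersX) x = merge_label mergersX (size mergersX) y.
Proof. by move: y; apply: ord5P; move: x; apply: ord5P; apply/eqP. Qed.

Lemma connectedY x y :
  merge_label mergersY (size mergersY) x = merge_label mergersY (size mergersY) y.
Proof. by move: y; apply: ord5P; move: x; apply: ord5P; apply/eqP. Qed.

Lemma connectedW x y :
  merge_label mergersW (size mergersW) x = merge_label mergersW (size mergersW) y.
Proof. by move: y; apply: ord5P; move: x; apply: ord5P; apply/eqP. Qed.

Lemma card_ord5 : (0 < #|'I_5|)%N.
Proof. by rewrite card_ord. Qed.

Notation points5 := [:: pt 0; pt 1; pt 2; pt 3; pt 4].

(** Here [w] is the multiplicity of each point in the tripod. Labels no longer in use give size 0,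
    which contributes no simplices. *)
Definition cluster_sizes (s : seq ('I_5 * 'I_5)) (w : 'I_5 -> nat) (j : nat) : seq nat :=
  [seq sumn [seq w x | x <- points5 & merge_label s j x == a] | a <- points5].

Lemma dim_level_clusters (F : fieldType) (Z : finType) (phi : Z -> 'I_5)
    (s : seq ('I_5 * 'I_5)) (w : 'I_5 -> nat) j k :
    (forall x, #|[pred z | phi z == x]| = w x) ->
  \dim (level_space F (fun j z => merge_label s j (phi z)) j k) =
  (\sum_(n <- cluster_sizes s w j) 'C(n, k.+1))%N.
Proof.
move=> wE; rewrite dim_level_space /cluster_sizes big_map big_pt.
apply: eq_bigr => a _; congr 'C(_, _).
rewrite -sum1_card (partition_big phi (fun x => merge_label s j x == a)) //.
rewrite big_pt sumnE big_map big_filter; apply: eq_bigr => x sx.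
rewrite -wE -sum1_card; apply: eq_bigl => z; rewrite !inE.
by case: (eqVneq (phi z) x) => [->|]; rewrite ?andbF ?andbT // sx.
Qed.

(* Applied to the first three mergers, [merge_sizes] gives a + b = a' + b',
   a + b + c = c' + d' and d + e = c' + d' + e'; comparing with the total
   a + ... + e = a' + ... + e' yields c = 0. *)
Lemma no_merge_weights (w w' : 'I_5 -> nat) :
    (forall x, 0 < w x)%N -> (forall x, 0 < w' x)%N ->
  ~ (forall j k, \sum_(n <- cluster_sizes mergersX w j) 'C(n, k.+1) =
                 \sum_(n <- cluster_sizes mergersY w' j) 'C(n, k.+1))%N.
Proof.
move=> w0 w'0 h.
(* Levels 0 to 3 surround the first three mergers; k = 1 counts edges, k = 2 triangles, and [h 0 0]
   the total weight. Differences of consecutive levels feed [merge_sizes]. *)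
move: (h 0 1)%N (h 0 2)%N (h 1 1)%N (h 1 2)%N (h 2 1)%N (h 2 2)%N (h 3 1)%N (h 3 2)%N.
move: (h 0 0)%N; rewrite /cluster_sizes /= !big_cons !big_nil /= !bin0n /=.
rewrite !(add0n, addn0, addnA, bin1).
move: (w0 (pt 0)) (w0 (pt 1)) (w0 (pt 2)) (w0 (pt 3)) (w0 (pt 4)).
move: (w (pt 0)) (w (pt 1)) (w (pt 2)) (w (pt 3)) (w (pt 4)) => a b c d e.
move: (w' (pt 0)) (w' (pt 1)) (w' (pt 2)) (w' (pt 3)) (w' (pt 4)) => a' b' c' d' e'.
move=> a0 b0 c0 d0 e0 total h01 h02 h11 h12 h21 h22 h31 h32.
have ab : (a + b = a' + b')%N by apply: merge_sizes; lia.
have abc : (a + b + c = c' + d')%N by apply: merge_sizes; lia.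
have de : (d + e = c' + d' + e')%N by apply: merge_sizes; lia.
lia.
Qed.

Lemma card_cor_fst (X Y : finType) (S : {set X * Y}) x :
  #|[pred p : {p : X * Y | p \in S} | (val p).1 == x]| = #|[pred y | (x, y) \in S]|.
Proof.
rewrite -(card_image val_inj) -[RHS](card_image (f := pair x)) => [|y y' []//].
apply: eq_card => -[x1 y1]; apply/imageP/imageP => [[p px pE]|[y yS [-> ->]]].
  have pS := valP p; rewrite /= -pE in pS.
  have {}px : x1 = x by rewrite -(eqP px) -pE.
  by exists y1; rewrite -px.
by exists (Sub (x, y) yS); rewrite ?inE /=.
Qed.

Lemma card_cor_snd (X Y : finType) (S : {set X * Y}) y :
  #|[pred p : {p : X * Y | p \in S} | (val p).2 == y]| = #|[pred x | (x, y) \in S]|.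
Proof.
rewrite -(card_image val_inj) -[RHS](card_image (f := pair^~ y)) => [|x x' []//].
apply: eq_card => -[x1 y1]; apply/imageP/imageP => [[p py pE]|[x xS [-> ->]]].
  have pS := valP p; rewrite /= -pE in pS.
  have {}py : y1 = y by rewrite -(eqP py) -pE.
  by exists x1; rewrite -py.
by exists (Sub (x, y) xS); rewrite ?inE /=.
Qed.

Lemma card_points5 (P : pred 'I_5) : #|P| = count P points5.
Proof. by rewrite -sum1_card big_pt -sum1_count. Qed.

(** * Bounds for the three spaces *)

Section Spaces.
Variables (F : fieldType) (R : realType).

Definition spaceX := merge_space connectedX R card_ord5.
Definition spaceY := merge_space connectedY R card_ord5.
Definition spaceW := merge_space connectedW R card_ord5.

(** An interleaving with delta < 1 bounds dimensions both ways, so the fiber sizes of the tripod,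
    positive by surjectivity, would be the weights excluded by [no_merge_weights]. *)
Lemma tripod_dist_ge1 (Z : finType) (phi : Z -> spaceX) (psi : Z -> spaceY) :
  surjection phi -> surjection psi -> (1 <= tripod_dist F phi psi)%E.
Proof.
move=> sphi spsi; apply: d_I_ge => delta d0 il; rewrite leNgt; apply/negP => d1.
pose w (x : 'I_5) := #|[pred z | phi z == x]|.
pose w' (y : 'I_5) := #|[pred z | psi z == y]|.
apply: (@no_merge_weights w w') => [x|y|j k].
- by have [z zx] := sphi x; apply/card_gt0P; exists z; rewrite inE zx.
- by have [z zx] := spsi y; apply/card_gt0P; exists z; rewrite inE zx.
have lX := level_labels_merge phi.
have lY := level_labels_merge psi.
rewrite -(@dim_level_clusters F Z phi) // -(@dim_level_clusters F Z psi) //.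
apply/eqP; rewrite eqn_leq (interleaved_dim_le lX lY d1 il).
by rewrite (interleaved_dim_le lY lX d1 (interleaved_sym il)).
Qed.

(** Equal multisets of cluster sizes give equal dimensions, hence a filtered isomorphism. The
    hypotheses are finite checks, since clusters are constant after the last merger. *)
Lemma cor_dist_merge_le0 (s s' : seq ('I_5 * 'I_5))
    (c : forall x y, merge_label s (size s) x = merge_label s (size s) y)
    (c' : forall x y, merge_label s' (size s') x = merge_label s' (size s') y)
    (f g : 'I_5 -> 'I_5)
    (w w' : 'I_5 -> nat) :
    (forall x, count (fun y => (y == f x) || (x == g y)) points5 = w x) ->
    (forall y, count (fun x => (y == f x) || (x == g y)) points5 = w' y) ->
    (forall j, (j <= maxn (size s) (size s'))%N ->
      perm_eq (cluster_sizes s w j) (cluster_sizes s' w' j)) ->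
  (cor_dist F (map_cor
     (f : merge_space c R card_ord5 -> merge_space c' R card_ord5) g) <= 0)%E.
Proof.
set m := maxn _ _; move=> wE w'E ws; set S := map_cor _ _.
pose X := merge_space c R card_ord5; pose Y := merge_space c' R card_ord5.
pose phi (p : cor_tripod (S : {set X * Y})) := (val p).1.
pose psi (p : cor_tripod (S : {set X * Y})) := (val p).2.
have label_const (s0 : seq ('I_5 * 'I_5)) j : (size s0 <= j)%N ->
    merge_label s0 j = merge_label s0 (size s0).
  by move=> sj; rewrite /merge_label take_oversize // take_size.
apply: (d_I_level_le0 (m := m) (level_labels_merge phi) (level_labels_merge psi)).
- by move=> x y; rewrite label_const ?leq_maxl.
- by move=> x y; rewrite label_const ?leq_maxr.
move=> j k; rewrite (@dim_level_clusters F _ phi s w); last first.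
  move=> x; rewrite card_cor_fst card_points5 -wE; apply: eq_count => y /=.
  exact: (@mem_map_cor R X Y f g x y).
rewrite (@dim_level_clusters F _ psi s' w'); last first.
  move=> y; rewrite card_cor_snd card_points5 -w'E; apply: eq_count => x /=.
  exact: (@mem_map_cor R X Y f g x y).
apply: perm_big; have [/ws //|mj] := leqP j m.
have := ws m (leqnn m); rewrite /cluster_sizes.
rewrite !(label_const s) ?leq_maxl ?(leq_trans _ (ltnW mj)) ?leq_maxl //.
by rewrite !(label_const s') ?leq_maxr ?(leq_trans _ (ltnW mj)) ?leq_maxr.
Qed.

(* With e of multiplicity 3, the third merger joins d to a cluster of size 3 in
   both spaces, namely e in X and abc in W. *)
Lemma dhat_XW_le0 sq : (dhat F sq spaceX spaceW <= 0)%E.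
Proof.
(* The correspondence pairs a, b, c with e, then d with d, and e with a, b, c. *)
pose f := pts [:: 4; 4; 4; 3; 0]%N.
pose w (x : 'I_5) := (nth 0 [:: 1; 1; 1; 1; 3] (val x))%N.
apply: le_trans (dhat_le_map F sq (f : spaceX -> spaceW) f) _.
apply: (@cor_dist_merge_le0 _ _ _ _ _ _ w w).
- by apply: ord5P.
- by apply: ord5P.
by move=> [|[|[|[|[|j]]]]].
Qed.

(* The second merger joins two clusters of sizes 1 and 2, and the third one
   clusters of sizes 1 and 3 (d and abc in W, e and cd in Y). *)
Lemma dhat_WY_le0 sq : (dhat F sq spaceW spaceY <= 0)%E.
Proof.
(* The correspondence pairs a and b of W with c, then c with d, d with e, and e with both a and
   b. *)
pose f := pts [:: 2; 2; 3; 4; 0]%N; pose g := pts [:: 4; 4; 0; 2; 3]%N.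
pose w (x : 'I_5) := (nth 0 [:: 1; 1; 1; 1; 2] (val x))%N.
pose w' (x : 'I_5) := (nth 0 [:: 1; 1; 2; 1; 1] (val x))%N.
apply: le_trans (dhat_le_map F sq (f : spaceW -> spaceY) g) _.
apply: (@cor_dist_merge_le0 _ _ _ _ _ _ w w').
- by apply: ord5P.
- by apply: ord5P.
by move=> [|[|[|[|[|j]]]]].
Qed.

End Spaces.

Theorem corollary6p12 (F : fieldType) (R : realType) (sq : tripod_kind) :
  exists X Y W : finMetric R,
    (dhat F sq X W + dhat F sq W Y < dhat F sq X Y)%E.
Proof.
exists (spaceX R), (spaceY R), (spaceW R).
apply: (@le_lt_trans _ _ 0%E).
  by rewrite -[0%E]adde0; apply: leeD; [exact: dhat_XW_le0|exact: dhat_WY_le0].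
apply: (@lt_le_trans _ _ 1%E); first exact: lte01.
by apply: dhat_ge_tripod => Z phi psi; exact: tripod_dist_ge1.
Qed.
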